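(* Let $H$ be an abelian group (written multiplicatively) and let $\mathbb{K}=H\cup\{0\}$ be the monoid obtained by adjoining an absorbing element $0$ to $H$. Let $s:\mathbb{K}\to\mathbb{K}$ be a bijection of the set $\mathbb{K}$ onto itself that commutes with its conjugates for the action of $H$ by multiplication on $\mathbb{K}$. If $s(0)\neq 0$, then the operation $$x+y:=\begin{cases} y & \text{if } x=0,\\ s(0)^{-1}\,x\,s\big(s(0)\,y\,x^{-1}\big) & \text{if } x\neq 0\end{cases}$$ defines a commutative group law on $\mathbb{K}$. With this law as addition, the monoid $\mathbb{K}$ (with its given multiplication) becomes a commutative field. Moreover, for $p$ a prime number, the field $\mathbb{K}$ is of characteristic $p$ if and only if the $p$-fold composition satisfies $$s^p=s\circ s\circ\cdots\circ s=\mathrm{id}.$$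
   Context: For $h\in H$ let $R_h:\mathbb{K}\to\mathbb{K}$ be $R_h(x)=hx$ (with $R_h(0)=0$). The conjugates of $s$ for the action of $H$ are the maps $R_h\circ s\circ R_h^{-1}$, $h\in H$; the hypothesis is that $s\circ(R_h\circ s\circ R_h^{-1})=(R_h\circ s\circ R_h^{-1})\circ s$ for all $h\in H$. The multiplication on $\mathbb{K}$ extends that of $H$ with $0\cdot x=x\cdot 0=0$ for all $x\in\mathbb{K}$. *)

(* Defs.v *)
From HB Require Import structures.
From mathcomp Require Import all_boot all_algebra.

Set Implicit Arguments.
Unset Strict Implicit.
Unset Printing Implicit Defensive.

Definition adjoin0 (H : groupType) : Type := option H.

HB.instance Definition _ (H : groupType) := Choice.on (adjoin0 H).

Section Monoid.
Variable H : groupType.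
Local Notation K := (adjoin0 H).
Local Open Scope group_scope.

Definition zero : K := None.
Definition emb (h : H) : K := Some h.

Definition mul0 (x y : K) : K :=
  match x, y with
  | Some g, Some h => Some (g * h)
  | _, _ => None
  end.

(* inv0 zero = zero is a junk value, as for the inverse of a MathComp field. *)
Definition inv0 (x : K) : K :=
  match x with
  | Some h => Some h^-1
  | None => None
  end.

Lemma mul0A : associative mul0.
Proof. by move=> [x|] [y|] [z|] //=; rewrite mulgA. Qed.

Lemma mul01x : left_id (emb 1) mul0.
Proof. by case=> [x|] //=; rewrite mul1g. Qed.

Lemma mul0x1 : right_id (emb 1) mul0.
Proof. by case=> [x|] //=; rewrite mulg1. Qed.

HB.instance Definition _ := isMonoid.Build K mul0A mul01x mul0x1.
HB.instance Definition _ := hasInv.Build K inv0.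

Definition scale (h : H) (x : K) : K := emb h * x.

Lemma scaleK (h : H) : cancel (scale h) (scale h^-1).
Proof.
case=> [x|] //.
by rewrite /scale mulgA -[_ * emb h]/(emb (h^-1 * h)) mulVg mul1g.
Qed.

Lemma scaleVK (h : H) : cancel (scale h^-1) (scale h).
Proof. by move=> x; rewrite -{1}[h]invgK scaleK. Qed.

(* By scaleK and scaleVK, scale h^-1 is the inverse map of scale h. *)
Definition conjugate (h : H) (s : K -> K) : K -> K :=
  scale h \o s \o scale h^-1.

Definition add_of (s : K -> K) (x y : K) : K :=
  if x == zero then y else (s zero)^-1 * x * s (s zero * y * x^-1).

End Monoid.

Arguments zero {H}.

Definition commutative_group_law (T : Type) (op : T -> T -> T) : Prop :=
  exists (e : T) (opp : T -> T),
    [/\ associative op, commutative op, left_id e op & left_inverse e opp op].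

(* Main.v *)
Require Import Defs.
From HB Require Import structures.
From mathcomp Require Import all_boot all_algebra.

Set Implicit Arguments.
Unset Strict Implicit.
Unset Printing Implicit Defensive.

(** Write a = s(0), an element of H.  For x = g in H the formula for x + y reads
    (a^-1 g) s((a^-1 g)^-1 y): the translation y |-> x + y is the conjugate of s
    by a^-1 g, and the translation by 0 is the identity ([addE], [add0K]).

    Since s commutes with all its conjugates, any two conjugates of s commute
    ([conjugate_comm]), hence so do any two translations; this says that
    x + (y + z) = y + (x + z).  The factor a^-1 is chosen so that the
    translation by x sends 0 to x.  These two facts alone give commutativity
    and associativity ([left_commutative_comm], [left_commutative_assoc]).
    Opposites exist because s is onto: -x is the point that the translation by
    x sends to 0.

    Conjugating by k g amounts to conjugating by g and then by k, which is the
    distributivity k (g + y) = k g + k y ([mulK_addr]).  As every nonzero element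
    of the monoid is invertible, this makes it a field.

    Finally s itself is the conjugate by 1 = a^-1 a, so s is the translation
    y |-> a + y ([bijection_translation]).  Its p-th iterate is the translation
    by p a; as a is nonzero in a field, p a = 0 exactly when p = 0 in the field
    ([pchar_iter_translation]). *)

Section CommutingTranslations.
Variables (T : Type) (op : T -> T -> T) (e : T).
Hypotheses (op_e : right_id e op) (opCA : left_commutative op).

Lemma left_commutative_comm : commutative op.
Proof. by move=> x y; rewrite -{1}[y]op_e opCA op_e. Qed.

Lemma left_commutative_assoc : associative op.
Proof.
by move=> x y z; rewrite [op y z]left_commutative_comm opCA left_commutative_comm.
Qed.

End CommutingTranslations.

(** The p-th iterate of y |-> a + y is y |-> p a + y, and p a = a (p 1). *)
Lemma pchar_iter_translation (F : fieldType) (a : F) (p : nat) :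
  a != 0%R -> prime p -> p \in [pchar F]%R <-> iter p (+%R a)%R =1 id.
Proof.
move=> a_neq0 p_prime.
have -> : p \in [pchar F]%R = (a *+ p == 0)%R.
  by rewrite inE p_prime -(GRing.mulr_natr a) GRing.mulf_eq0 (negPf a_neq0).
split=> [/eqP pa0 x|iter_id]; first by rewrite GRing.iter_addr pa0 GRing.add0r.
by rewrite -[X in X == _]GRing.addr0 -GRing.iter_addr iter_id.
Qed.

Section AdditionFromBijection.
Variable H : groupType.
Local Notation K := (adjoin0 H).
Local Open Scope group_scope.
Implicit Types (g h : H) (x y z : K).

Lemma scaleM g h x : scale g (scale h x) = scale (g * h) x.
Proof. by rewrite /scale mulgA. Qed.

(** Conjugation by g reduces this to the case of s and its conjugate by
    g^-1 h. *)
Lemma conjugate_comm (s : K -> K) :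
  (forall h, s \o conjugate h s =1 conjugate h s \o s) ->
  forall g h x,
    conjugate g s (conjugate h s x) = conjugate h s (conjugate g s x).
Proof.
move=> sC g h x; have /= := sC (g^-1 * h) (scale g^-1 x).
rewrite /conjugate /= !scaleM invgM invgK -!mulgA mulgV mulg1.
by move/(congr1 (scale g)); rewrite !scaleM mulgA mulgV mul1g.
Qed.

Lemma conjugateM (s : K -> K) g h x :
  conjugate (g * h) s (scale g x) = scale g (conjugate h s x).
Proof. by rewrite /conjugate /= invgM -!scaleM scaleK. Qed.

Lemma oneK_neq0 : (1 : K) != zero. Proof. by []. Qed.

Lemma invK0 : (zero : K)^-1 = zero. Proof. by []. Qed.

Lemma mulVK x : x != zero -> x^-1 * x = 1.
Proof. by case: x => // g _; congr Some; exact: mulVg. Qed.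

Hypothesis mulHC : forall g h : H, g * h = h * g.

Lemma mulKC x y : x * y = y * x.
Proof. by case: x y => [g|] [h|] //; congr Some; exact: mulHC. Qed.

Variables (s t : K -> K) (a : H).
Hypothesis tK : cancel t s.
Hypothesis sC : forall h, s \o conjugate h s =1 conjugate h s \o s.
Hypothesis s0 : s zero = emb a.

Local Notation add := (add_of s).

Lemma add0K : left_id zero add.
Proof. by move=> y; rewrite /add_of eqxx. Qed.

(** All the properties of the addition are read off from this form of the
    translations, in which s(0) occurs only as the constant a. *)
Lemma addE g y : add (emb g) y = conjugate (a^-1 * g) s y.
Proof.
rewrite /add_of s0 /= /conjugate /= /scale; congr (_ * s _).
rewrite mulKC mulgA; congr (_ * y).
by congr Some; rewrite invgM invgK.
Qed.

Lemma addK0 : right_id zero add.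
Proof.
case=> [g|]; last exact: add0K.
rewrite (addE g) /conjugate /= [scale _ zero]/(zero) s0.
by congr Some; rewrite -mulgA mulHC -mulgA mulgV mulg1.
Qed.

Lemma addCA : left_commutative add.
Proof. by case=> [g|] [h|] z; rewrite ?add0K // !addE conjugate_comm. Qed.

Lemma addC : commutative add.
Proof. exact: (left_commutative_comm addK0 addCA). Qed.

Lemma addA : associative add.
Proof. exact: (left_commutative_assoc addK0 addCA). Qed.

(** For x = g nonzero, this solves h s(h^-1 y) = 0 for y, where h = a^-1 g. *)
Definition opp x : K := if x is Some g then scale (a^-1 * g) (t zero) else zero.

Lemma addNK : left_inverse zero opp add.
Proof.
move=> x; rewrite addC; case: x => [g|]; last exact: add0K.
by rewrite (addE g) /conjugate /= scaleK tK.
Qed.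

Lemma mulK_addr : right_distributive ( *%g : K -> K -> K) add.
Proof.
(* If k or g is zero, both sides agree by computation. *)
case=> [k|] [g|] y //.
rewrite -[Some k]/(emb k) -[Some g]/(emb g) [emb k * emb g]/(emb (k * g)).
rewrite !addE (mulgA a^-1) (mulHC a^-1 k) -(mulgA k).
by rewrite -[emb k * y]/(scale k y) conjugateM.
Qed.

Lemma mulK_addl : left_distributive ( *%g : K -> K -> K) add.
Proof. by move=> x y z; rewrite ![_ * z]mulKC mulK_addr. Qed.

Lemma bijection_translation y : s y = add (emb a) y.
Proof. by rewrite addE mulVg /conjugate /= invg1 /scale !mul1g. Qed.

End AdditionFromBijection.

Theorem theorem2p1 (H : groupType) (s : adjoin0 H -> adjoin0 H) :
  (forall g h : H, (g * h = h * g)%g) ->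
  bijective s ->
  (forall h : H, s \o conjugate h s =1 conjugate h s \o s) ->
  s zero <> zero ->
  commutative_group_law (add_of s) /\
  exists c : GRing.Field (adjoin0 H),
    let F : fieldType := GRing.Field.Pack c in
    [/\ forall x y : F, (x + y)%R = add_of s x y,
        forall x y : F, (x * y)%R = ((x : adjoin0 H) * (y : adjoin0 H))%g
      & forall p : nat, prime p ->
          (p \in [pchar F]%R <-> iter p s =1 id)].
Proof.
move=> mulHC [t _ tK] sC; case s0: (s zero) => [a|] // _.
split.
  exists zero, (opp t a).
  split; [exact: (addA mulHC sC s0) | exact: (addC mulHC sC s0)
         | exact: add0K | exact: (addNK mulHC tK sC s0)].
pose Z := GRing.isZmodule.Build (adjoin0 H) (addA mulHC sC s0)
  (addC mulHC sC s0) (add0K s) (addNK mulHC tK sC s0).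
pose V : zmodType := HB.pack (adjoin0 H) Z.
pose R := GRing.Zmodule_isComNzRing.Build V (@mul0A H) (mulKC mulHC)
  (@mul01x H) (mulK_addl mulHC s0) (oneK_neq0 H).
pose A : comNzRingType := HB.pack V R.
pose D := GRing.ComNzRing_isField.Build A (@mulVK H) (invK0 H).
pose F : fieldType := HB.pack A D.
exists (GRing.Field.class F); split=> // p p_prime.
pose b : F := (emb a : adjoin0 H).
have iter_s : iter p s =1 iter p (+%R b)%R.
  exact/eq_iter/(bijection_translation mulHC s0).
have pcharP := pchar_iter_translation (isT : b != 0%R) p_prime.
split=> [/pcharP iter_id x|iter_id]; first by rewrite iter_s iter_id.
by apply/pcharP => x; rewrite -iter_s iter_id.
Qed.
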